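(* Let $d\ge1$, let $\mathbb X$ be the set of all tableaux and $\mathbb Y_d$ the set of all tableaux whose row $d$ is identical to row $d+1$. Then $T\mapsto\alpha_d(T)$ is a bijection $\mathbb X\to\mathbb Y_d$, whose inverse deletes row $d+1$ and moves every row of index greater than $d+1$ up one row. Let $T\in\mathbb X$, $\widetilde T=\alpha_d(T)$, $l=l(T)=l(\widetilde T)$, and let $b$ be the length of row $d$ (in both $T$ and $\widetilde T$). Then: (1) The first $d$ rows of $T$ are identical to those of $\widetilde T$; in particular $b=0$ iff $T=\widetilde T$. (2) For every $j\ge d$, row $j$ of $T$ is identical to row $j+1$ of $\widetilde T$. Each of the first $b$ columns of $\widetilde T$ has length one more than the corresponding column of $T$. (3) Suppose $b>0$. Let $B$ and $\widetilde B$ be the end-boxes of the $l$-sets of $T$ and $\widetilde T$, and $x_B$ the row index of $B$. Then: (a) $x_B<d$ iff $B=\widetilde B$ iff the $l$-sets of $T$ and $\widetilde T$ are equal; (b) $x_B\ge d$ iff $\widetilde B$ is $B$ translated down one unit; (c) the $l$-set of $T$ begins in a row of index greater than $d$ iff the $l$-set of $\widetilde T$ begins in a row of index greater than $d+1$ iff the $l$-set of $\widetilde T$ is the $l$-set of $T$ translated down one unit; (d) if $x_B\ge d$, then the $l$-set of $T$ is the set of last boxes of all rows $1,\dots,x_B$ iff the $l$-set of $\widetilde T$ is the set of last boxes of all rows $1,\dots,x_B+1$. (4) Suppose the prime path of row $d$ in $T$ has height $d$ (equivalently, the prime path of row $d$ in $\widetilde T$ has height $d$). Then $T$ is a $\psi$-tableau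 iff $\widetilde T$ is a $\psi$-tableau.
   Context: Young diagrams use English notation: rows indexed $1,2,\dots$ top to bottom, columns $1,2,\dots$ left to right, $(x,y)$ the box in row $x$, column $y$, row lengths $\lambda_1\ge\lambda_2\ge\cdots$, $\lambda_j=0$ beyond the last row, $\lambda_0=+\infty$; $[m]=\{1,\dots,m\}$. For $d\ge1$, the height of the prime path of row $d$ of $Y$ is $h_Y(d)=\min\{h\ge1:\lambda_{d-h}\ge\lambda_d+h\}$. If $B$ is the last box of row $x_B$, the $B$-strip is the set of last boxes of rows $x_B-h_Y(x_B)+1,\dots,x_B$; $B$ is a corner box if it is also lowest in its column. $Y'\gtrdot Y$ if $Y'$ is $Y$ with the $B$-strip of some corner box $B$ deleted. A tableau $T$ fills a Young diagram with positive integers, rows strictly increasing left to right, columns weakly increasing downward, label set exactly $[l]$ for some $l\ge0$, $l=l(T)$ its length; the $r$-set is the set of boxes labelled $r$; $T^{(r)}$ consists of boxes with labels $\le r$. A nonempty set of boxes begins in its row of minimum index and ends in its row of maximum index; its end-box is its box in the row of maximum index. Two rows are identical if they have the same length and labels. A set $S$ of boxes translated down one unit is $\{(x+1,y):(x,y)\in S\}$. A $\psi$-tableau is a tableau with $sh(T^{(r-1)})\gtrdot sh(T^{(r)})$ for all $r\in[l(T)]$. For $d\ge1$, $\alpha_d(T)$ is obtained from a tableau $T$ by moving every row of index $>d$ down one row and placing a copy of row $d$ in row $d+1$. *)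

(* Defs.v *)
From HB Require Import structures.
From mathcomp Require Import all_boot finmap.

Set Implicit Arguments.
Unset Strict Implicit.
Unset Printing Implicit Defensive.

Local Open Scope fset_scope.

(* All row and column indices are 1-based. *)
Definition box : Type := (nat * nat)%type.

(* A Young diagram is given by the sequence of its positive row lengths. *)
Definition is_young (Y : seq nat) : Prop := sorted geq Y /\ 0 \notin Y.

(* Only meaningful for 0 < i; it is 0 beyond the last row. *)
Definition row_len (Y : seq nat) (i : nat) : nat := nth 0 Y i.-1.

(* lambda_i >= m, with the convention lambda_0 = +oo *)
Definition row_len_ge (Y : seq nat) (i m : nat) : bool :=
  (i == 0) || (m <= row_len Y i).

Definition boxes (Y : seq nat) : {fset box} :=
  [fset p | p in [seq (x, y) | x <- iota 1 (size Y), y <- iota 1 (row_len Y x)]].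

Definition col_len (Y : seq nat) (y : nat) : nat :=
  #|` [fset p in boxes Y | p.2 == y] |.

Lemma prime_height_ex (Y : seq nat) (d : nat) :
  exists h, (0 < h) && row_len_ge Y (d - h) (row_len Y d + h).
Proof. by exists d.+1; rewrite /row_len_ge subnS subnn. Qed.

(* For d >= 1 the value h = d is always admissible, so the truncation of d - h
   when h > d never matters. *)
Definition prime_height (Y : seq nat) (d : nat) : nat :=
  ex_minn (prime_height_ex Y d).

Definition last_box (Y : seq nat) (x : nat) : box := (x, row_len Y x).

Definition last_boxes (Y : seq nat) (m n : nat) : {fset box} :=
  [fset last_box Y x | x in index_iota m n.+1].

Definition strip (Y : seq nat) (B : box) : {fset box} :=
  last_boxes Y (B.1 - prime_height Y B.1 + 1) B.1.

Definition is_corner (Y : seq nat) (B : box) : Prop :=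
  [/\ B \in boxes Y, B = last_box Y B.1
    & forall x, B.1 < x -> (x, B.2) \notin boxes Y].

(* The diagram with fewer boxes is the larger one: this is Y' :> Y. *)
Definition covers (Y' Y : seq nat) : Prop :=
  exists2 B, is_corner Y B & boxes Y' = boxes Y `\` strip Y B.

(* A filling is the sequence of its nonempty rows of labels; the library's
   shape T is then the sequence of row lengths of its underlying diagram. *)
Definition filling : Type := seq (seq nat).

(* Only meaningful for 0 < i; it is the empty row beyond the last row. *)
Definition row (T : filling) (i : nat) : seq nat := nth [::] T i.-1.

Definition label (T : filling) (B : box) : nat := nth 0 (row T B.1) B.2.-1.

(* The largest label; for a tableau, whose labels are 1, ..., l, this is l. *)
Definition len (T : filling) : nat := \max_(k <- flatten T) k.

Lemma len_uniq (T : filling) (l : nat) : flatten T =i iota 1 l -> len T = l.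
Proof.
move=> eqT; apply/eqP; rewrite eqn_leq; apply/andP; split.
  by apply/bigmax_leqP_seq => k; rewrite eqT mem_iota add1n ltnS => /andP[].
case: l eqT => // l eqT; apply: (@leq_bigmax_seq _ (flatten T) xpredT id) => //.
by rewrite eqT mem_iota add1n ltnS leqnn.
Qed.

Definition is_tableau (T : filling) : Prop :=
  [/\ is_young (shape T),
      all (sorted ltn) T,
      forall x y, (x, y) \in boxes (shape T) -> (x.+1, y) \in boxes (shape T) ->
        label T (x, y) <= label T (x.+1, y)
    & exists l, flatten T =i iota 1 l].

Definition label_set (T : filling) (r : nat) : {fset box} :=
  [fset B in boxes (shape T) | label T B == r].

(* T^(r) *)
Definition restrict (T : filling) (r : nat) : filling :=
  [seq s <- [seq [seq k <- t | k <= r] | t <- T] | s != [::]].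

Definition begins_in (S : {fset box}) (x : nat) : Prop :=
  (exists2 B, B \in S & B.1 = x) /\ forall B, B \in S -> x <= B.1.

(* Unique when S has at most one box in each row, as the sets label_set T r of a
   tableau do. *)
Definition is_end_box (S : {fset box}) (B : box) : Prop :=
  B \in S /\ forall C, C \in S -> C.1 <= B.1.

Definition box_down (B : box) : box := (B.1.+1, B.2).

Definition translate_down (S : {fset box}) : {fset box} :=
  [fset box_down B | B in S].

Definition is_psi_tableau (T : filling) : Prop :=
  is_tableau T /\
  forall r, 0 < r <= len T ->
    covers (shape (restrict T r.-1)) (shape (restrict T r)).

(* If row d is empty, its copy is an empty row, which is not stored. *)
Definition alpha (d : nat) (T : filling) : filling :=
  if d <= size T then take d T ++ row T d :: drop d T else T.

Definition delete_row (i : nat) (T : filling) : filling :=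
  take i.-1 T ++ drop i T.

Definition is_tableau_rep (d : nat) (T : filling) : Prop :=
  is_tableau T /\ row T d = row T d.+1.

(* Main.v *)
(* Copying row d replaces the function i |-> row i by its composite with
   i |-> i - (d < i). Everything except (4) follows by transporting along this
   reindexing, since the largest label can only occur at the end of a row.

   For (4), the prime path of row d has full height d exactly when
   row lengths satisfy f i < f d + (d - i) for 0 < i < d. If this holds, a prime
   path starting in a row x >= d either stops in a row >= d or runs up to
   row 1, both before and after the duplication; so deleting the strip of x
   commutes with duplicating row d. Moreover a strip which meets row d then
   meets every row above it, so the bound survives the deletion, and one can
   descend through the shapes of T^(l), T^(l-1), and so on. *)

Require Import Defs.
From mathcomp Require Import all_boot finmap zify.

Set Implicit Arguments.
Unset Strict Implicit.
Unset Printing Implicit Defensive.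

(** * Prime paths and coverings for functions of row lengths, and their behaviour when a row is
    duplicated *)

Definition copy_src (d i : nat) : nat := i - (d < i).

Definition nonincreasing (f : nat -> nat) : Prop :=
  forall i j, 0 < i -> i <= j -> f j <= f i.

(* [h = x] is always admissible: this is the convention lambda_0 = +oo. *)
Definition has_prime_height (f : nat -> nat) (x h : nat) : Prop :=
  [/\ 0 < h, h <= x, h = x \/ f x + h <= f (x - h)
    & forall k, 0 < k < h -> f (x - k) < f x + k].

(** The relation [covers] read on row lengths: [x] is the row of the corner box, [h] the height of
    its prime path. Arbitrary functions are allowed, so that [f \o copy_src d] can be used
    directly. *)
Definition fcovers (f' f : nat -> nat) : Prop :=
  exists x h, [/\ 0 < f x, forall j, x < j -> f j < f x, has_prime_height f x h
    & forall i, 0 < i -> f' i = f i - (x - h < i <= x)].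

Lemma prime_height_full_bound f d :
  has_prime_height f d d -> forall i, 0 < i < d -> f i < f d + (d - i).
Proof.
case=> _ _ _ H i id.
by have := H (d - i); rewrite subKn; [apply; lia | lia].
Qed.

Lemma bound_prime_height_full f d : 0 < d ->
  (forall i, 0 < i < d -> f i < f d + (d - i)) -> has_prime_height f d d.
Proof.
move=> d0 H; split=> //; first by left.
by move=> k kd; have := H (d - k); rewrite subKn; [apply; lia | lia].
Qed.

(** Suppose the path stopped in a row [x - h] with [0 < x - h < d]. Having passed row [d] gives
    [f d < f x + (x - d)] when [d < x], and the full height of row [d] gives
    [f (x - h) < f d + (d - (x - h))]. Together, [f (x - h) < f x + h], against the stopping
    condition. *)
Lemma has_prime_height_row0 f d x h : has_prime_height f d d ->
  has_prime_height f x h -> d <= x -> x - h < d -> h = x.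
Proof.
move=> /prime_height_full_bound low [h0 hx [//|jump] below] dx xhd.
case: (ltnP h x) => [hlt|]; last lia.
have := low (x - h); have := below (x - d); rewrite subKn //.
by case: (eqVneq d x) => [E|]; [subst x|]; lia.
Qed.

Lemma has_prime_height_fcovers f f' d : nonincreasing f ->
  has_prime_height f d d -> fcovers f' f -> has_prime_height f' d d.
Proof.
move=> finc phd [x [h [fx0 _ phx f'E]]].
have [d0 _ _ _] := phd.
have low := prime_height_full_bound phd.
apply: bound_prime_height_full => // i id.
rewrite !f'E; try lia.
have := low i id; have fid := finc i d; have fdx := finc d x.
case: (leqP d x) => [dx|]; last lia.
case: (ltnP (x - h) d) => [xhd|]; last lia.
(* The strip now reaches row 1, so rows [i] and [d] both lose one box. Both are nonempty because row
   [x] is, so the truncated subtraction is exact. *)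
have -> := has_prime_height_row0 phd phx dx xhd.
lia.
Qed.

Lemma has_prime_height_copy_lt f d x h : x <= d ->
  has_prime_height (f \o copy_src d) x h <-> has_prime_height f x h.
Proof.
rewrite /has_prime_height /= => xd.
have E k : copy_src d (x - k) = x - k by rewrite /copy_src; lia.
have E0 : copy_src d x = x by rewrite /copy_src; lia.
split=> -[h0 hx jump below]; split=> //.
- by move: jump; rewrite E E0.
- by move=> k /below; rewrite E E0.
- by rewrite E E0.
- by move=> k /below; rewrite E E0.
Qed.

(** Such a path meets only rows of index at least [d], and the duplicate repeats these one row
    lower. Running off the top is excluded by [h <= x - d < x]. *)
Lemma has_prime_height_copy_ge f d x h : 0 < d -> d <= x -> h <= x - d ->
  has_prime_height (f \o copy_src d) x.+1 h <-> has_prime_height f x h.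
Proof.
rewrite /has_prime_height /= => d0 dx hxd.
have E k : k <= x - d -> copy_src d (x.+1 - k) = x - k by rewrite /copy_src; lia.
have E0 : copy_src d x.+1 = x by rewrite /copy_src; lia.
split=> -[h0 hx jump below]; split=> //; try lia.
- by move: jump; rewrite E // E0; case; [lia|right].
- by move=> k kh; have := below k kh; rewrite E ?E0 //; lia.
- by move: jump; rewrite E // E0; case; [lia|right].
- by move=> k kh; have := below k kh; rewrite E ?E0 //; lia.
Qed.

Lemma has_prime_height_copy_full f d x :
  has_prime_height f d d -> d <= x ->
  has_prime_height (f \o copy_src d) x.+1 x.+1 <-> has_prime_height f x x.
Proof.
move=> phd dx; have [d0 _ _ _] := phd.
have low := prime_height_full_bound phd.
have srcL i : i <= d -> copy_src d i = i by rewrite /copy_src; lia.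
have srcR i : d <= i -> copy_src d i.+1 = i by rewrite /copy_src; lia.
split=> ph; have low' := prime_height_full_bound ph;
  apply: bound_prime_height_full; try lia; move=> i ix.
- have /= := low' i.+1; rewrite (srcR x) //.
  case: (leqP d i) => [di|id]; first by rewrite srcR //; lia.
  (* For [i < d] the bound at row [i] of the duplicate is one unit too weak. Instead the bounds from
     [i] to [d] and from [d] to [x] are added, the second being void when [d = x]. *)
  have /= := low' d.+1; have := low i; rewrite (srcR d) // (srcR x) //.
  by case: (eqVneq d x) => [E|]; [subst x|]; lia.
- rewrite /= (srcR x) //.
  case: (leqP i d) => [id|di]; last first.
    by case: i di ix => // i di ix; rewrite srcR //; have := low' i; lia.
  by rewrite srcL //; have := low' i; case: (eqVneq i x) => [E|]; [subst x|]; lia.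
Qed.

(** A strip starting above row [d] is unaffected. A strip starting in a row [x >= d] either stays
    strictly below row [d] and shifts down, or meets every row up to row 1 and gains one box. In all
    cases deleting it commutes with the duplication. *)
Lemma fcovers_copy f f' d : has_prime_height f d d ->
  fcovers (f' \o copy_src d) (f \o copy_src d) <-> fcovers f' f.
Proof.
move=> phd; have [d0 _ _ _] := phd.
have srcL i : i <= d -> copy_src d i = i by rewrite /copy_src; lia.
have srcR i : d <= i -> copy_src d i.+1 = i by rewrite /copy_src; lia.
have srcd : copy_src d d = copy_src d d.+1 by rewrite srcL // srcR.
have phd' : has_prime_height (f \o copy_src d) d d by apply/has_prime_height_copy_lt.
split=> -[x [h [/= fx0 cor phx f'E]]].
  case: (ltngtP x d) => [xd|dx|xd].
  - exists x, h; rewrite srcL ?(ltnW xd) // in fx0 cor.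
    split=> //.
    + move=> j xj; case: (leqP j d) => [jd|dj]; first by have := cor j xj; rewrite srcL.
      by have := cor j.+1; rewrite (srcR _ (ltnW dj)) //; apply; lia.
    + by apply/(has_prime_height_copy_lt f h (ltnW xd)).
    + move=> i i0; case: (leqP i d) => [id|di]; first by have := f'E i i0; rewrite srcL.
      by have := f'E i.+1 isT; rewrite (srcR _ (ltnW di)) // => ->; congr (_ - nat_of_bool _); lia.
  - case: x dx fx0 cor phx f'E => // x dx; rewrite !srcR // => fx0 cor phx f'E.
    (* Row [d] cannot stop the path: row [d.+1] is equally long and either was reached one step
       earlier or is the starting row. A stop above row [d] forces the full height. *)
    have hE : h <= x - d \/ h = x.+1.
      case: (leqP h (x - d)) => [|xdh]; [by left|right].
      case: (leqP (x.+1 - h) d) => [hd|]; last lia.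
      move: hd; rewrite leq_eqVlt => /orP[/eqP hd|hd].
        case: (phx) => h0 _ [->//|/=] + /(_ h.-1); rewrite hd -/(copy_src d x.+1) /= => jump below.
        have hd' : x.+1 - h.-1 = d.+1 by case: phx; lia.
        rewrite hd' -srcd srcR // srcL // in jump below.
        by case: (eqVneq h 1) => h1; [have xd : x = d by lia|]; [rewrite xd in jump|]; lia.
      by apply: (has_prime_height_row0 phd' phx) => //; lia.
    (* [minn h x] keeps a height [h <= x - d] and turns the full height [x.+1] into [x]. *)
    exists x, (minn h x); split=> //.
    + by move=> j xj; have := cor j.+1 xj; rewrite srcR //; lia.
    + case: hE => hE; first by rewrite (minn_idPl _); [apply/(has_prime_height_copy_ge f d0 dx hE)|lia].
      by rewrite hE in phx *; rewrite (minn_idPr _) //; apply/(has_prime_height_copy_full phd dx).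
    + move=> i i0; case: (leqP i d) => [id|di].
        by have := f'E i i0; rewrite srcL // => ->; congr (_ - nat_of_bool _); lia.
      by have := f'E i.+1 isT; rewrite (srcR _ (ltnW di)) // => ->; congr (_ - nat_of_bool _); lia.
  (* The duplicate has no corner in row [d], since row [d.+1] is equally long. *)
  - by have := cor d.+1; rewrite -srcd xd ltnn ltnS leqnn => /(_ isT).
case: (ltnP x d) => [xd|dx].
  exists x, h; split=> /=; rewrite ?(srcL x (ltnW xd)) //.
  - move=> j xj; apply: cor; rewrite /copy_src; lia.
  - by apply/(has_prime_height_copy_lt f h (ltnW xd)).
  - by move=> i i0; rewrite f'E /copy_src; [congr (_ - nat_of_bool _)|]; lia.
exists x.+1, (if h <= x - d then h else x.+1); split=> /=; rewrite ?srcR //.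
- by move=> j xj; apply: cor; rewrite /copy_src; lia.
- case: leqP => xdh; first by apply/has_prime_height_copy_ge.
  apply/(has_prime_height_copy_full phd dx).
  have hx : h = x by apply: (has_prime_height_row0 phd phx) => //; lia.
  by rewrite hx in phx.
- have := has_prime_height_row0 phd phx dx.
  move=> hx i i0; rewrite f'E; last by rewrite /copy_src; lia.
  congr (_ - nat_of_bool _); case: (leqP i d) => [id|di].
    by rewrite srcL //; case: (leqP h (x - d)); lia.
  by case: i di {i0} => // i di; rewrite srcR //; case: (leqP h (x - d)); lia.
Qed.

Lemma eq_fcovers f g f' g' : f =1 g -> f' =1 g' -> fcovers f' f -> fcovers g' g.
Proof.
move=> fg fg' [x [h [fx0 cor [h0 hx jump below] f'E]]].
exists x, h; split; [by rewrite -fg | by move=> j; rewrite -!fg; apply: cor | |].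
  by split=> //; [rewrite -!fg | move=> k; rewrite -!fg; apply: below].
by move=> i; rewrite -fg -fg'; apply: f'E.
Qed.

(** Full height is assumed only at the top stage [l], whereas each use of [fcovers_copy] needs it at
    its own stage. Peeling off the top covering first lets [has_prime_height_fcovers] pass it
    down. *)
Lemma fcovers_chain_copy (F : nat -> nat -> nat) d l :
  (forall r, nonincreasing (F r)) -> has_prime_height (F l) d d ->
  (forall r, 0 < r <= l -> fcovers (F r.-1) (F r)) <->
  (forall r, 0 < r <= l -> fcovers (F r.-1 \o copy_src d) (F r \o copy_src d)).
Proof.
move=> Finc; elim: l => [|l IH] phd; first by split=> _ [|r] //.
have stepE := @fcovers_copy (F l.+1) (F l) d phd.
split=> H.
  have step : fcovers (F l) (F l.+1) by apply: (H l.+1); rewrite /= ltnSn.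
  have /IH [IH' _] := has_prime_height_fcovers (Finc _) phd step.
  move=> r /andP[r0]; rewrite leq_eqVlt => /predU1P[->|rl]; first exact/stepE.
  by apply: IH'; [move=> s sl; apply: H; lia | lia].
(* The covering is known here only for the duplicates. It is pulled back first, so that full height
   can descend from [F l.+1] to [F l]. *)
have step : fcovers (F l) (F l.+1) by apply/stepE/(H l.+1); rewrite /= ltnSn.
have /IH [_ IH'] := has_prime_height_fcovers (Finc _) phd step.
move=> r /andP[r0]; rewrite leq_eqVlt => /predU1P[->//|rl].
by apply: IH'; [move=> s sl; apply: H; lia | lia].
Qed.

(** * Translation between sets of boxes and row lengths *)

Lemma mem_boxes Y x y :
  ((x, y) \in boxes Y) = (0 < x) && (0 < y <= row_len Y x).
Proof.
rewrite /boxes in_fset /=; apply/allpairsPdep/idP.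
  by case=> a [c [ha hc [-> ->]]]; rewrite !mem_iota in ha hc; lia.
move=> /andP[x0 xy]; exists x, y; split=> //; rewrite mem_iota; last by lia.
case: (leqP x (size Y)) => [|hx]; first lia.
by move: xy; rewrite /row_len nth_default; lia.
Qed.

Lemma mem_last_boxes Y m n x y :
  ((x, y) \in last_boxes Y m n) = (m <= x <= n) && (y == row_len Y x).
Proof.
apply/imfsetP/idP => /=.
  by case=> a; rewrite mem_index_iota => han [-> ->]; rewrite eqxx; lia.
move=> /andP[hx /eqP ->]; exists x => //; rewrite mem_index_iota; lia.
Qed.

Lemma prime_heightP Y d : 0 < d ->
  has_prime_height (row_len Y) d (prime_height Y d).
Proof.
rewrite /prime_height => d0; case: ex_minnP => h /andP[h0 jump] hmin.
have hd : h <= d by apply: hmin; rewrite d0 /row_len_ge subnn.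
split=> //; first by move: jump => /orP[/eqP|]; [left; lia | right].
move=> k /andP[k0 kh]; rewrite ltnNge; apply/negP => hk.
suff: h <= k by lia.
by apply: hmin; rewrite k0 /row_len_ge hk orbT.
Qed.

Lemma has_prime_height_uniq f x h h' :
  has_prime_height f x h -> has_prime_height f x h' -> h = h'.
Proof.
wlog hh : h h' / h < h'.
  move=> W; case: (ltngtP h h') => [hh|hh|//] p p'; first exact: (W h h').
  by apply/esym; apply: (W h' h).
case=> [h0 hx jump _] [_ h'x _ /(_ h)].
by case: jump; lia.
Qed.

Lemma prime_heightE Y d h : 0 < d ->
  prime_height Y d = h <-> has_prime_height (row_len Y) d h.
Proof.
move=> d0; split=> [<-|ph]; first exact: prime_heightP.
exact: has_prime_height_uniq (prime_heightP Y d0) ph.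
Qed.

Lemma coversE Y' Y : nonincreasing (row_len Y) ->
  covers Y' Y <-> fcovers (row_len Y') (row_len Y).
Proof.
move=> Yinc.
have stripE x : 0 < x -> boxes Y' = (boxes Y `\` strip Y (last_box Y x))%fset <->
    forall i, 0 < i ->
      row_len Y' i = row_len Y i - (x - prime_height Y x < i <= x).
  move=> x0; split=> [YE i i0|H].
    have E y : 0 < y -> (y <= row_len Y' i) =
        (y <= row_len Y i) &&
        ~~ ((x - prime_height Y x < i <= x) && (y == row_len Y i)).
      move=> y0; have /fsetP/(_ (i, y)) := YE.
      rewrite in_fsetD !mem_boxes mem_last_boxes /= i0 y0 /= => ->.
      by rewrite addn1 andbC.
    (* Four columns suffice to determine the new row end: [row_len Y i] and its predecessor,
       [row_len Y' i] and its successor. *)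
    have := E (row_len Y' i); have := E (row_len Y i).
    have := E (row_len Y i).-1; have := E (row_len Y' i).+1.
    rewrite !leqnn !ltnn.
    by case: (_ < i <= x) => /=; lia.
  apply/fsetP => -[i y].
  rewrite in_fsetD !mem_boxes mem_last_boxes /= addn1.
  by case: (posnP i) => i0 /=; rewrite ?andbF // H //; lia.
split.
  case=> -[x y] [/= Bbox [yE] low] YE; rewrite {}yE in Bbox low YE.
  move: Bbox; rewrite mem_boxes => /and3P[x0 y0 _].
  exists x, (prime_height Y x); split=> //; last exact/stripE.
    move=> j xj; have := low j xj; rewrite mem_boxes; lia.
  exact: prime_heightP.
case=> x [h [y0 low ph YE]].
have x0 : 0 < x by case: ph; lia.
have hE := has_prime_height_uniq ph (prime_heightP Y x0); rewrite {}hE in YE.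
exists (last_box Y x); last exact/stripE.
split=> //; first by rewrite mem_boxes x0 y0 leqnn.
by move=> j /= xj; rewrite mem_boxes; have := low j xj; lia.
Qed.

(** * Fillings and tableaux described row by row *)

Lemma row_len_shape T i : row_len (shape T) i = size (row T i).
Proof.
rewrite /row_len /row; case: (ltnP i.-1 (size T)) => hi.
  by rewrite (nth_map [::]).
by rewrite !nth_default ?size_map.
Qed.

(** Since no stored row is empty, the number of rows can be read off [row] in spite of its padding
    by empty rows. *)
Lemma filling_ext (T T' : filling) : [::] \notin T -> [::] \notin T' ->
  (forall i, 0 < i -> row T i = row T' i) -> T = T'.
Proof.
move=> TN T'N E.
have le (S S' : filling) : [::] \notin S -> (forall i, 0 < i -> row S i = row S' i) ->
    size S <= size S'.
  move=> SN ES; rewrite leqNgt; apply/negP => lt.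
  have := ES (size S').+1 isT; rewrite /row /= [RHS]nth_default // => SE.
  by move/negP: SN; apply; rewrite -SE mem_nth.
apply: (@eq_from_nth _ [::]); last by move=> i _; apply: (E i.+1).
by apply/eqP; rewrite eqn_leq !le // => i i0; rewrite E.
Qed.

Lemma mem_flatten_row T k :
  k \in flatten T <-> exists2 i, 0 < i & k \in row T i.
Proof.
split=> [/flattenP[s sT ks]|[i i0 ki]].
  by exists (index s T).+1; rewrite // /row /= nth_index.
apply/flattenP; exists (row T i) => //; rewrite mem_nth //.
by case: ltnP => // hi; rewrite /row nth_default in ki.
Qed.

Lemma row_leq_len T i k : k \in row T i -> k <= len T.
Proof.
move=> ki; apply: (@leq_bigmax_seq _ (flatten T) xpredT id) => //.
apply/flattenP; exists (row T i) => //; rewrite mem_nth //.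
by case: ltnP => // hi; rewrite /row nth_default in ki.
Qed.

(** The conditions on row lengths and labels now involve only single rows and pairs of consecutive
    rows, a form that passes through a reindexing of the rows. *)
Lemma is_tableauE T : is_tableau T <->
  [/\ [::] \notin T, forall i, sorted ltn (row T i),
      forall i, 0 < i -> size (row T i.+1) <= size (row T i),
      forall i y, 0 < i -> y < size (row T i.+1) ->
        nth 0 (row T i) y <= nth 0 (row T i.+1) y
    & exists l, flatten T =i iota 1 l].
Proof.
have nilE : (0 \in shape T) = ([::] \in T).
  by apply/mapP/idP => [[[|//] sT _]|sT]; [|exists [::]].
have sortE : sorted geq (shape T) <->
    forall i, 0 < i -> size (row T i.+1) <= size (row T i).
  split=> [/(sortedP 0) H [|i] // _|H].
    rewrite -!row_len_shape /row_len /=.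
    case: (ltnP i.+1 (size (shape T))) => [/H //|hi].
    by rewrite nth_default.
  by apply/(sortedP 0) => i _; have := H i.+1 isT; rewrite -!row_len_shape.
split.
  case=> -[sY nT] /allP rowsT colT lT; split=> //.
  - by rewrite -nilE.
  - move=> i; rewrite /row; case: (ltnP i.-1 (size T)) => hi.
      by apply: rowsT; rewrite mem_nth.
    by rewrite nth_default.
  - exact/sortE.
  - move=> i y i0 yi; have := colT i y.+1.
    rewrite !mem_boxes !row_len_shape i0 /label /=; apply; last by [].
    exact: leq_trans yi (proj1 sortE sY i i0).
case=> nT rowsT sizeT colT lT; split=> //.
- by split; [apply/sortE | rewrite nilE].
- by apply/allP => s sT; have := rowsT (index s T).+1; rewrite /row /= nth_index.
- move=> x [|y]; rewrite !mem_boxes !row_len_shape ?andbF //= => /andP[x0 _] xy.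
  exact: colT.
Qed.

(** * Duplicating and deleting a row *)

Lemma row_alpha d T i : 0 < d -> row (alpha d T) i = row T (copy_src d i).
Proof.
rewrite /alpha /copy_src /row => d0; case: (leqP d (size T)) => dT.
  rewrite nth_cat size_takel //; case: ltnP => id.
    have -> : d < i = false by lia.
    by rewrite subn0 nth_take.
  have di : d < i by lia.
  rewrite di subn1; case: (eqVneq i d.+1) => [-> /=|id1]; first by rewrite subnn.
  have -> : i.-1 - d = (i - d.+2).+1 by lia.
  by rewrite /= nth_drop; congr (nth _ _ _); lia.
case: (ltnP d i) => di; last by rewrite subn0.
by rewrite !nth_default //; lia.
Qed.

Lemma row_delete d T i : 0 < i ->
  row (delete_row d.+1 T) i = row T (i + (d < i)).
Proof.
rewrite /delete_row /row /= => i0; rewrite nth_cat size_take_min.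
case: (leqP d (size T)) => dT.
  case: (ltnP d i) => di.
    have -> : i.-1 < d = false by lia.
    by rewrite nth_drop; congr nth; lia.
  have id : i.-1 < d by lia.
  by rewrite id nth_take // addn0.
case: ltnP => iT.
  by rewrite nth_take; [congr nth|]; lia.
by rewrite nth_drop !nth_default //; lia.
Qed.

Lemma nil_notin_alpha d T : 0 < d -> [::] \notin T -> [::] \notin alpha d T.
Proof.
move=> d0 nT; rewrite /alpha; case: leqP => // dT.
rewrite mem_cat inE !negb_or; apply/and3P; split.
- by apply: contra nT => /mem_take.
- by apply: contra nT => /eqP ->; rewrite mem_nth // prednK.
- by apply: contra nT => /mem_drop.
Qed.

Lemma nil_notin_delete i T : [::] \notin T -> [::] \notin delete_row i T.
Proof.
move=> nT; rewrite mem_cat negb_or; apply/andP; split.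
  by apply: contra nT => /mem_take.
by apply: contra nT => /mem_drop.
Qed.

Lemma flatten_alpha d T : 0 < d -> flatten (alpha d T) =i flatten T.
Proof.
move=> d0 k; apply/idP/idP => /mem_flatten_row[i i0].
  rewrite row_alpha // => ki; apply/mem_flatten_row; exists (copy_src d i) => //.
  by rewrite /copy_src; lia.
(* [i + (d < i)] is the section of [copy_src d] that avoids row [d.+1]. *)
move=> ki; apply/mem_flatten_row; exists (i + (d < i)); first lia.
have srcK : copy_src d (i + (d < i)) = i by rewrite /copy_src; lia.
by rewrite row_alpha // srcK.
Qed.

Lemma alphaK d T : 0 < d -> [::] \notin T -> delete_row d.+1 (alpha d T) = T.
Proof.
move=> d0 nT; apply: filling_ext => //.
  exact/nil_notin_delete/nil_notin_alpha.
by move=> i i0; rewrite row_delete // row_alpha //; congr row; rewrite /copy_src; lia.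
Qed.

Lemma delete_rowK d T : 0 < d -> [::] \notin T -> row T d = row T d.+1 ->
  alpha d (delete_row d.+1 T) = T.
Proof.
move=> d0 nT rowE; apply: filling_ext => //.
  exact/nil_notin_alpha/nil_notin_delete.
move=> i i0; rewrite row_alpha // row_delete; last by rewrite /copy_src; lia.
have [->|id] := eqVneq i d.+1.
  by rewrite -rowE; congr row; rewrite /copy_src; lia.
by congr row; rewrite /copy_src; lia.
Qed.

Lemma is_tableau_alpha d T : 0 < d -> is_tableau T -> is_tableau (alpha d T).
Proof.
move=> d0 /is_tableauE[nT rowsT sizeT colT lT].
(* Consecutive rows of the duplicate come from a single row or from consecutive rows of [T]. *)
have srcS i : 0 < i -> copy_src d i.+1 = copy_src d i \/
    copy_src d i.+1 = (copy_src d i).+1 /\ 0 < copy_src d i.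
  by rewrite /copy_src; lia.
apply/is_tableauE; split.
- exact: nil_notin_alpha.
- by move=> i; rewrite row_alpha.
- move=> i i0; rewrite !row_alpha //.
  by have [->|[-> si0]] := srcS i i0; last exact: sizeT.
- move=> i y i0; rewrite !row_alpha //.
  by have [->|[-> si0]] := srcS i i0; last exact: colT.
- by case: lT => l lE; exists l => k; rewrite flatten_alpha.
Qed.

Lemma is_tableau_delete d T : 0 < d -> is_tableau T -> row T d = row T d.+1 ->
  is_tableau (delete_row d.+1 T).
Proof.
move=> d0 /is_tableauE[nT rowsT sizeT colT lT] rowE.
(* As rows [d] and [d.+1] agree, [d <= i] may replace [d < i]. Rows [i] and [i.+1] after the
   deletion then come from consecutive rows of [T], even for [i = d]. *)
have rowdE i : 0 < i -> row (delete_row d.+1 T) i = row T (i + (d <= i)).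
  move=> i0; rewrite row_delete //; have [->|id] := eqVneq i d.
    by rewrite ltnn leqnn addn0 addn1.
  by congr row; lia.
have rowdSE i : row (delete_row d.+1 T) i.+1 = row T (i + (d <= i)).+1.
  by rewrite row_delete.
apply/is_tableauE; split.
- exact: nil_notin_delete.
(* Index 0 reads the same row as index 1, so every index can be treated as a successor. *)
- move=> i; have -> : row (delete_row d.+1 T) i = row (delete_row d.+1 T) i.-1.+1 by [].
  by rewrite row_delete.
- by move=> i i0; rewrite rowdSE rowdE // sizeT //; lia.
- by move=> i y i0; rewrite rowdSE rowdE //; apply: colT; lia.
- case: lT => l lE; exists l => k; rewrite -lE -{2}(delete_rowK d0 nT rowE).
  by rewrite flatten_alpha.
Qed.

(** * The restrictions $T^{(r)}$ and $\psi$-tableaux *)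

(** Empty entries form a tail, so the filter removes only values that the default of [nth]
    restores. *)
Lemma nth_filter_nonnil (s : seq (seq nat)) i :
  (forall j, nth [::] s j = [::] -> nth [::] s j.+1 = [::]) ->
  nth [::] [seq t <- s | t != [::]] i = nth [::] s i.
Proof.
elim: s i => [|t s IH] i H //=.
case: eqVneq => [t0|_] /=; last by case: i => // i; apply: IH => j; apply: (H j.+1).
have snil j : nth [::] (t :: s) j = [::] by elim: j => [|j IHj]; [|apply: H].
rewrite snil IH; first exact: (snil i.+1).
by move=> j _; apply: (snil j.+2).
Qed.

(** Labels weakly increase down columns, so a row without labels up to [r] is followed by another
    such row. Hence [restrict] discards only bottom rows and renumbers none. *)
Lemma row_restrict T r i : is_tableau T ->
  row (restrict T r) i = [seq k <- row T i | k <= r].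
Proof.
move=> /is_tableauE[nT rowsT sizeT colT lT].
have nthE j : nth [::] [seq [seq k <- t | k <= r] | t <- T] j =
    [seq k <- nth [::] T j | k <= r].
  case: (ltnP j (size T)) => jT; first by rewrite (nth_map [::]).
  by rewrite !nth_default ?size_map.
rewrite /row /restrict nth_filter_nonnil // => j; rewrite !nthE => emp.
apply/eqP; rewrite -[_ == _]negbK -has_filter; apply/hasPn => k ks.
have kE := nth_index 0 ks; have := ks; rewrite -index_mem => klt.
have := colT j.+1 _ isT klt; rewrite /row /= kE => le.
have : ~~ has (leq^~ r) (nth [::] T j) by rewrite has_filter emp.
move=> /hasPn/(_ (nth 0 (nth [::] T j) (index k (nth [::] T j.+1)))).
rewrite -!ltnNge; move=> H; apply: leq_trans le; apply: H.
by rewrite mem_nth //; apply: leq_trans klt (sizeT j.+1 isT).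
Qed.

Lemma count_pointwise (a : pred nat) s t : size t <= size s ->
  (forall y, y < size t -> a (nth 0 t y) -> a (nth 0 s y)) ->
  count a t <= count a s.
Proof.
elim: t s => [|x t IH] [|z s] //= ts H.
apply: leq_add; last by apply: IH => // y; apply: (H y.+1).
by have := H 0 isT; case: (a x) => //= ->.
Qed.

(** A label at most [r] below the first row has a label at most [r] directly above it, so the number
    of such labels cannot grow from one row to the next. *)
Lemma nonincreasing_row_restrict T r : is_tableau T ->
  nonincreasing (row_len (shape (restrict T r))).
Proof.
move=> tT; have [_ _ sizeT colT _] := proj1 (is_tableauE T) tT.
have step i : 0 < i -> row_len (shape (restrict T r)) i.+1 <=
    row_len (shape (restrict T r)) i.
  move=> i0; rewrite !row_len_shape !row_restrict // !size_filter.
  apply: count_pointwise => [|y yi]; first exact: sizeT.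
  exact/leq_trans/colT.
move=> i j i0; elim: j => [|j IHj]; first by lia.
rewrite leq_eqVlt => /predU1P[->//|ij].
by apply: leq_trans (step j _) (IHj _); lia.
Qed.

Lemma len_alpha d T : 0 < d -> is_tableau T -> len (alpha d T) = len T.
Proof.
move=> d0 /is_tableauE[_ _ _ _ [l lE]]; rewrite (len_uniq lE).
by apply: len_uniq => k; rewrite flatten_alpha.
Qed.

Lemma is_psi_tableauE T : is_tableau T -> is_psi_tableau T <->
  forall r, 0 < r <= len T ->
    fcovers (row_len (shape (restrict T r.-1))) (row_len (shape (restrict T r))).
Proof.
move=> tT; split=> [[_ H] r rl|H].
  by apply/coversE/H; first exact: nonincreasing_row_restrict.
by split=> // r rl; apply/coversE/H; first exact: nonincreasing_row_restrict.
Qed.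

Lemma is_psi_tableau_alpha d T : is_tableau T ->
  has_prime_height (row_len (shape T)) d d ->
  is_psi_tableau T <-> is_psi_tableau (alpha d T).
Proof.
move=> tT phd; have [d0 _ _ _] := phd.
have tTt := is_tableau_alpha d0 tT.
pose F r := row_len (shape (restrict T r)).
(* Restriction acts within each row, so it commutes with the duplication. *)
have FE r : F r \o copy_src d =1 row_len (shape (restrict (alpha d T) r)).
  by move=> i; rewrite /F /= !row_len_shape !row_restrict // row_alpha.
(* At [r = len T] no label is removed, so full height in [T] starts the descent. *)
have FlE i : F (len T) i = row_len (shape T) i.
  rewrite /F !row_len_shape row_restrict //; congr size.
  by apply/all_filterP/allP => k; apply: row_leq_len.
have phl : has_prime_height (F (len T)) d d.
  apply: bound_prime_height_full => // i id.
  by rewrite !FlE; apply: prime_height_full_bound id.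
have chain := fcovers_chain_copy (fun r => nonincreasing_row_restrict r tT) phl.
rewrite !is_psi_tableauE // len_alpha // chain.
by split=> H r rl; apply: eq_fcovers (H r rl) => // i; rewrite -FE.
Qed.

(** * The boxes with the largest label, and column lengths *)

Lemma mem_label_set_len T x y : is_tableau T ->
  ((x, y) \in label_set T (len T)) =
  [&& 0 < x, len T \in row T x & y == size (row T x)].
Proof.
move=> /is_tableauE[nT rowsT _ _ _].
have lastE z : z < size (row T x) -> nth 0 (row T x) z = len T ->
    z = (size (row T x)).-1.
  move=> zx zl; apply/eqP; rewrite eqn_leq -ltnS (ltn_predK zx) zx /=.
  rewrite leqNgt; apply/negP => zlt.
  have px : (size (row T x)).-1 < size (row T x) by rewrite (ltn_predK zx).
  have := sorted_ltn_nth ltn_trans 0 (rowsT x) _ _ zx px zlt.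
  by rewrite zl ltnNge (row_leq_len (mem_nth 0 px)).
rewrite /label_set in_fset inE /= mem_boxes row_len_shape /label /=.
apply/andP/and3P => [[/and3P[x0 y0 yx] /eqP yl]|[x0 lx /eqP ->]].
  have yx' : y.-1 < size (row T x) by rewrite prednK.
  split=> //; first by rewrite -yl mem_nth.
  by have := lastE _ yx' yl; lia.
have lE := nth_index 0 lx; have := lx; rewrite -index_mem => llt.
by rewrite x0 leqnn (leq_trans _ llt) //= -(lastE _ llt lE) lE.
Qed.

(** A nonempty row makes [len T] positive, hence one of the labels 1, ..., [len T], all of which
    occur. *)
Lemma len_in_row T i : is_tableau T -> 0 < size (row T i) ->
  exists2 x, 0 < x & len T \in row T x.
Proof.
move=> /is_tableauE[_ _ _ _ [l lE]] b0.
apply/mem_flatten_row; rewrite (len_uniq lE) lE mem_iota.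
have : 0 < len T.
  have [k ki] : exists k, k \in row T i by case: (row T i) b0 => // k s _; exists k; rewrite inE eqxx.
  have kT : k \in flatten T.
    apply/flattenP; exists (row T i) => //; rewrite mem_nth //.
    by case: ltnP => // hi; rewrite /row nth_default in ki.
  have := row_leq_len ki; rewrite lE mem_iota in kT; lia.
rewrite (len_uniq lE); lia.
Qed.

Lemma col_lenE Y y : 0 < y -> col_len Y y = count (leq y) Y.
Proof.
move=> y0; rewrite /col_len.
have -> : [fset p in boxes Y | p.2 == y]%fset =
    [fset (x, y) | x in [seq x <- iota 1 (size Y) | y <= row_len Y x]]%fset.
  apply/fsetP => -[x z]; rewrite in_fset inE /= mem_boxes.
  apply/idP/imfsetP => /= [/andP[/and3P[x0 z0 zx] /eqP zy]|[a]].
    exists x; last by rewrite zy.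
    rewrite mem_filter -zy zx mem_iota x0 /=; case: ltnP => //.
    by move=> hx; rewrite /row_len nth_default in zx; lia.
  by rewrite mem_filter mem_iota => /andP[ya /andP[a0 _]] [-> ->]; rewrite a0 y0 ya eqxx.
rewrite card_imfset /=; last by move=> a c [].
rewrite undup_id ?filter_uniq ?iota_uniq // size_filter.
by rewrite -{3}(mkseq_nth 0 Y) /mkseq count_map -(addn0 1) iotaDl count_map.
Qed.

Section RowGraph.
(* [P] and [g] describe a set of boxes with at most one box in each row. *)
Variables (S : {fset box}) (P : pred nat) (g : nat -> nat).
Hypothesis SE : forall i y, ((i, y) \in S) = P i && (y == g i).

Lemma unique_end_box x : P x -> (forall i, P i -> i <= x) ->
  unique (is_end_box S) (x, g x).
Proof.
move=> Px xmax; split.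
  split; first by rewrite SE Px eqxx.
  by case=> i y; rewrite SE => /andP[/xmax].
case=> i y; rewrite /is_end_box SE => -[/andP[Pi /eqP ->] imax].
suff -> : x = i by [].
by apply/eqP; rewrite eqn_leq (xmax i Pi) (imax (x, g x)) // SE Px eqxx.
Qed.

Lemma begins_after x c : P x ->
  (exists2 i, begins_in S i & c < i) <-> (forall i, P i -> c < i).
Proof.
move=> Px; split=> [[k [_ kmin] ck] i Pi|H].
  by apply: leq_trans ck (kmin (i, g i) _); rewrite SE Pi eqxx.
have exP : exists i, P i by exists x.
case: (ex_minnP exP) => k Pk kmin; exists k; last exact: H.
split; first by exists (k, g k); rewrite // SE Pk eqxx.
by case=> i y; rewrite SE => /andP[/kmin].
Qed.

Lemma eq_last_boxes Y x : (forall i, g i = row_len Y i) ->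
  (forall i, P i -> 0 < i <= x) ->
  S = last_boxes Y 1 x <-> (forall i, 0 < i <= x -> P i).
Proof.
move=> gE Px; split=> [SY i ix|H].
  by have := SE i (g i); rewrite SY mem_last_boxes ix gE eqxx !andbT => <-.
apply/fsetP => -[i y]; rewrite SE mem_last_boxes gE; congr andb.
by apply/idP/idP => [/Px|/H].
Qed.

End RowGraph.

Lemma mem_translate_down S x y :
  ((x, y) \in translate_down S) = (0 < x) && ((x.-1, y) \in S).
Proof.
apply/imfsetP/andP => /= [[[a c] aS [-> ->]] //|[x0 xS]].
by exists (x.-1, y); rewrite // /box_down /= prednK.
Qed.

Lemma row_gt0 d T : 0 < d -> [::] \notin T ->
  (0 < size (row T d)) = (d <= size T).
Proof.
move=> d0 nT; rewrite /row; case: (leqP d (size T)) => dT.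
  rewrite lt0n size_eq0; apply/idP; apply: contraNneq nT => <-.
  by rewrite mem_nth // prednK.
by rewrite nth_default // -ltnS prednK.
Qed.

Lemma label_set_alpha d T : 0 < d -> is_tableau T -> 0 < size (row T d) ->
  let Tt := alpha d T in
  let l := len T in
  exists B Bt : box,
    unique (is_end_box (label_set T l)) B /\
    unique (is_end_box (label_set Tt l)) Bt /\
    ((B.1 < d <-> B = Bt) /\ (B = Bt <-> label_set T l = label_set Tt l)) /\
    (d <= B.1 <-> Bt = box_down B) /\
    (((exists2 x, begins_in (label_set T l) x & d < x) <->
      (exists2 x, begins_in (label_set Tt l) x & d.+1 < x)) /\
     ((exists2 x, begins_in (label_set Tt l) x & d.+1 < x) <->
      label_set Tt l = translate_down (label_set T l))) /\
    (d <= B.1 ->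
     (label_set T l = last_boxes (shape T) 1 B.1 <->
      label_set Tt l = last_boxes (shape Tt) 1 B.1.+1)).
Proof.
move=> d0 tT b0 Tt l.
pose P i := (0 < i) && (l \in row T i).
pose g i := size (row T i).
pose Pt i := P (copy_src d i).
pose gt i := g (copy_src d i).
have SE i y : ((i, y) \in label_set T l) = P i && (y == g i).
  by rewrite mem_label_set_len // /P andbA.
have StE i y : ((i, y) \in label_set Tt l) = Pt i && (y == gt i).
  rewrite /l -(len_alpha d0 tT) mem_label_set_len; last exact: is_tableau_alpha.
  rewrite len_alpha // row_alpha // andbA /Pt /P; congr (_ && _ && _).
  by rewrite /copy_src; lia.
have exP : exists x, P x.
  by have [x x0 lx] := len_in_row tT b0; exists x; rewrite /P x0.
have Pbound x : P x -> x <= size T.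
  move=> /andP[x0]; rewrite /row; case: (leqP x (size T)) => // hx.
  by rewrite nth_default //; lia.
case: (ex_maxnP exP Pbound) => x Px xmax.
have x0 : 0 < x by case/andP: Px.
(* When [x = d] the row has two copies and the end-box lies in the lower one, hence [d <= x] and not
   [d < x]. *)
pose xt := x + (d <= x).
have srcx : copy_src d xt = x by rewrite /copy_src /xt; lia.
have Pxt : Pt xt by rewrite /Pt srcx.
have xtmax i : Pt i -> i <= xt.
  by move=> /xmax; rewrite /copy_src /xt; lia.
have srcL i : i <= d -> copy_src d i = i by rewrite /copy_src; lia.
have srcR i : d <= i -> copy_src d i.+1 = i by rewrite /copy_src; lia.
have bg := begins_after SE d Px; have bgt := begins_after StE d.+1 Pxt.
exists (x, g x), (xt, gt xt).
split; first exact: unique_end_box.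
split; first exact: unique_end_box.
have BE : x < d <-> (x, g x) = (xt, gt xt).
  rewrite /gt srcx; split=> [xd|[]]; last by rewrite /xt; lia.
  by congr pair; rewrite /xt; lia.
split; first split=> //.
  rewrite -BE; split=> [xd|SS].
    apply/fsetP => -[i y]; rewrite SE StE /Pt /gt.
    case: (leqP i d) => [id|di]; first by rewrite srcL.
    have /negbTE-> : ~~ P i by apply: contraTN di => /xmax; lia.
    suff /negbTE-> : ~~ P (copy_src d i) by [].
    by apply: contraTN di => /xmax; rewrite /copy_src; lia.
  (* If the two sets agree, row [xt] of [T] also contains [l], so [xt <= x] and therefore
     [x < d]. *)
  have := StE xt (gt xt); rewrite -SS SE Pxt eqxx => /andP[/xmax + _].
  by rewrite /xt; lia.
split.
  rewrite /box_down /gt srcx /=; split=> [dx|[]]; last by rewrite /xt; lia.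
  by congr pair; rewrite /xt; lia.
split.
  rewrite bg bgt; split; split.
  - by move=> H i /H; rewrite /copy_src; lia.
  - move=> H i Pi; case: (ltnP d i) => // id.
    by have := H i; rewrite /Pt srcL // => /(_ Pi); lia.
  - move=> H; apply/fsetP => -[i y]; rewrite mem_translate_down SE StE.
    case: (ltnP d.+1 i) => di.
      by case: i di => // i di; rewrite /Pt /gt srcR //; lia.
    have /negbTE-> : ~~ Pt i by apply: contraTN di => /H; lia.
    suff /negbTE-> : ~~ P i.-1 by rewrite andbF.
    apply/negP => Pi; have := H i.-1; rewrite /Pt srcL; last by lia.
    by move=> /(_ Pi); lia.
  (* A row [i <= d] of [T] containing [l] is also row [i] of the duplicate, so by the translation
     row [i.-1] of [T] contains [l] too. Induction then gives [d < i.-1], which is impossible. *)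
  - move=> SS; have Hd i : P i -> d < i.
      elim/ltn_ind: i => i IH Pi; case: (ltnP d i) => // id.
      have := StE i (g i); rewrite SS mem_translate_down SE /Pt /gt srcL //.
      rewrite Pi eqxx => /and3P[i0 Pi1 _].
      by have := IH i.-1; rewrite prednK // leqnn => /(_ isT Pi1); lia.
    by move=> i /Hd; rewrite /copy_src; lia.
rewrite /= => dx.
(* Both equalities say that every row down to the end-box contains [l]; for [d <= x], [copy_src d]
   maps the rows 1, ..., [x.+1] onto 1, ..., [x]. *)
have -> : label_set T l = last_boxes (shape T) 1 x <->
    forall i, 0 < i <= x -> P i.
  apply: (eq_last_boxes SE) => [i|i Pi]; first by rewrite row_len_shape.
  by rewrite xmax // andbT; case/andP: Pi.
have -> : label_set Tt l = last_boxes (shape Tt) 1 x.+1 <->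
    forall i, 0 < i <= x.+1 -> Pt i.
  apply: (eq_last_boxes StE) => [i|i Pi].
    by rewrite row_len_shape row_alpha.
  by move: (Pi) (xtmax i Pi); rewrite /xt dx /Pt /P /copy_src; lia.
split=> H i ix; first by apply: H; rewrite /copy_src; lia.
case: (leqP i d) => id; first by have := H i; rewrite /Pt srcL //; apply; lia.
by have := H i.+1; rewrite /Pt srcR //; [apply|]; lia.
Qed.

(** * The bijection and the four assertions *)

Theorem theorem3p11 (d : nat) (hd : 0 < d) :
  (* bijection from tableaux onto tableaux with equal rows d, d + 1 *)
  [/\ forall T, is_tableau T -> is_tableau_rep d (alpha d T),
      forall T, is_tableau_rep d T -> is_tableau (delete_row d.+1 T),
      forall T, is_tableau T -> delete_row d.+1 (alpha d T) = T
    & forall T, is_tableau_rep d T -> alpha d (delete_row d.+1 T) = T] /\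
  forall T : filling, is_tableau T ->
  let Tt := alpha d T in
  let l := len T in
  let b := size (row T d) in
  len Tt = l /\ size (row Tt d) = b /\
  (* 1 *)
  ((forall i, 0 < i <= d -> row T i = row Tt i) /\ (b = 0 <-> T = Tt)) /\
  (* 2 *)
  ((forall j, d <= j -> row T j = row Tt j.+1) /\
   (forall y, 0 < y <= b ->
      col_len (shape Tt) y = (col_len (shape T) y).+1)) /\
  (* 3 *)
  (0 < b ->
   exists B Bt : box,
     unique (is_end_box (label_set T l)) B /\
     unique (is_end_box (label_set Tt l)) Bt /\
     (* a *)
     ((B.1 < d <-> B = Bt) /\ (B = Bt <-> label_set T l = label_set Tt l)) /\
     (* b *)
     (d <= B.1 <-> Bt = box_down B) /\
     (* c *)
     (((exists2 x, begins_in (label_set T l) x & d < x) <->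
       (exists2 x, begins_in (label_set Tt l) x & d.+1 < x)) /\
      ((exists2 x, begins_in (label_set Tt l) x & d.+1 < x) <->
       label_set Tt l = translate_down (label_set T l))) /\
     (* d *)
     (d <= B.1 ->
      (label_set T l = last_boxes (shape T) 1 B.1 <->
       label_set Tt l = last_boxes (shape Tt) 1 B.1.+1))) /\
  (* 4 *)
  ((prime_height (shape T) d = d <-> prime_height (shape Tt) d = d) /\
   (prime_height (shape T) d = d -> (is_psi_tableau T <-> is_psi_tableau Tt))).
Proof.
split.
  split=> T.
  - move=> tT; split; first exact: is_tableau_alpha.
    by rewrite !row_alpha // /copy_src ltnn ltnSn subn0 subn1.
  - by case=> tT rowE; apply: is_tableau_delete.
  - by move=> /is_tableauE[nT _ _ _ _]; apply: alphaK.
  - by case=> /is_tableauE[nT _ _ _ _] rowE; apply: delete_rowK.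
move=> T tT Tt l b.
have [nT _ _ _ _] := proj1 (is_tableauE T) tT.
have rowL i : i <= d -> row Tt i = row T i.
  by move=> id; rewrite row_alpha //; congr row; rewrite /copy_src; lia.
have rowR j : d <= j -> row Tt j.+1 = row T j.
  by move=> dj; rewrite row_alpha //; congr row; rewrite /copy_src; lia.
split; first exact: len_alpha.
split; first by rewrite rowL.
split; first split.
- by move=> i /andP[_ id]; rewrite rowL.
(* [b = 0] means that row [d] lies beyond the last row, where [alpha] changes nothing; otherwise
   [alpha] adds a row. *)
- have -> : b = 0 <-> (d <= size T) = false.
    by rewrite -row_gt0 // /b; case: (size _).
  rewrite /Tt /alpha; case: (leqP d (size T)) => dT; split=> // TE.
  have := congr1 size TE; rewrite size_cat /= size_takel // size_drop.
  by rewrite addnS subnKC // => /n_Sn.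
split; first split.
- by move=> j dj; rewrite rowR.
- move=> y /andP[y0 yb]; rewrite !col_lenE // /Tt /alpha.
  have dT : d <= size T by rewrite -row_gt0 //; apply: leq_trans yb.
  rewrite dT -[in RHS](cat_take_drop d T) /shape !map_cat /= !count_cat /=.
  by rewrite yb addnCA.
split; first exact: label_set_alpha.
have phE : prime_height (shape T) d = d <-> prime_height (shape Tt) d = d.
  (* Full height of row [d] is a condition on rows 1, ..., [d] only, and these agree. *)
  have lE i : i <= d -> row_len (shape Tt) i = row_len (shape T) i.
    by move=> id; rewrite !row_len_shape rowL.
  rewrite !prime_heightE //; split=> /prime_height_full_bound low;
    apply: bound_prime_height_full => // i id; have := low i id;
    by rewrite !lE //; lia.
by split=> // /prime_heightE-/(_ hd) phd; apply: is_psi_tableau_alpha.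
Qed.
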